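(* Let $d,n\geq 1$ be integers and $u\in\mathbb{C}\setminus\{0,1\}$. For every $1\le i\le n-1$ the generator $g_i$ of the Yokonuma--Hecke algebra $\mathrm{Y}_{d,n}(u)$ satisfies the cubic relation $$g_i^3=-u\,g_i^2+g_i+u,$$ equivalently, $$g_i^{-1}=u^{-1}g_i^2+g_i-u^{-1}.$$
   Context: The Yokonuma--Hecke algebra $\mathrm{Y}_{d,n}(u)$ is the unital associative $\mathbb{C}$-algebra with generators $g_1,\dots,g_{n-1},t_1,\dots,t_n$ and relations: $g_ig_j=g_jg_i$ for $|i-j|>1$; $g_ig_jg_i=g_jg_ig_j$ for $|i-j|=1$; $t_it_j=t_jt_i$ for all $i,j$; $t_jg_i=g_it_{s_i(j)}$ for all $i,j$, where $s_i=(i,i+1)$; $t_j^d=1$ for all $j$; and $g_i^2=1+(u-1)e_{d,i}-(u-1)e_{d,i}g_i$ for all $i$, where $e_{d,i}=\frac1d\sum_{m=0}^{d-1}t_i^mt_{i+1}^{-m}$. *)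

(* Defs.v *)
(* MathComp, with classical choice from mathcomp.classical. *)
From HB Require Import structures.
From mathcomp Require Import all_boot all_order all_algebra all_fingroup.
From mathcomp Require Import generic_quotient ring_quotient.
From mathcomp Require Import boolp reals complex.
From mathcomp Require Import finmap monalg.

Set Implicit Arguments.
Unset Strict Implicit.
Unset Printing Implicit Defensive.

Import GRing.Theory Num.Theory.
Local Open Scope ring_scope.
Local Open Scope quotient_scope.

Section GeneratedIdeal.
Variables (A : nzRingType) (rel : A -> Prop).

(* The two-sided ideal generated by the elements satisfying rel. *)
Definition genideal_prop (a : A) : Prop :=
  exists2 s : seq (A * A * A),
    (forall p, p \in s -> rel p.1.2) & a = \sum_(p <- s) p.1.1 * p.1.2 * p.2.

Definition genideal : {pred A} := fun a => `[< genideal_prop a >].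

Lemma genidealP a : reflect (genideal_prop a) (a \in genideal).
Proof. exact: asboolP. Qed.

Lemma genideal_zmod_closed : zmod_closed genideal.
Proof.
split; first by apply/genidealP; exists [::]; rewrite ?big_nil.
move=> a b /genidealP[s Hs ->] /genidealP[r Hr ->]; apply/genidealP.
exists (s ++ [seq (- p.1.1, p.1.2, p.2) | p <- r]).
  move=> p; rewrite mem_cat => /orP[/Hs //|/mapP[q /Hr Hq -> //]].
rewrite big_cat big_map /= -sumrN; congr (_ + _).
by apply: eq_bigr => p _; rewrite !mulNr.
Qed.

HB.instance Definition _ := GRing.isZmodClosed.Build A genideal
  genideal_zmod_closed.

Lemma genidealMl a b : b \in genideal -> a * b \in genideal.
Proof.
move=> /genidealP[s Hs ->]; apply/genidealP.
exists [seq (a * p.1.1, p.1.2, p.2) | p <- s].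
  by move=> p /mapP[q /Hs Hq ->].
by rewrite big_map mulr_sumr; apply: eq_bigr => p _; rewrite /= !mulrA.
Qed.

Lemma genidealMr a b : a \in genideal -> a * b \in genideal.
Proof.
move=> /genidealP[s Hs ->]; apply/genidealP.
exists [seq (p.1.1, p.1.2, p.2 * b) | p <- s].
  by move=> p /mapP[q /Hs Hq ->].
by rewrite big_map mulr_suml; apply: eq_bigr => p _; rewrite /= !mulrA.
Qed.

Lemma genideal_rel a : rel a -> a \in genideal.
Proof.
move=> Ra; apply/genidealP; exists [:: (1, a, 1)]; last first.
  by rewrite big_seq1 /= mulr1 mul1r.
by move=> p; rewrite inE => /eqP ->.
Qed.

End GeneratedIdeal.

(* MathComp algebras are nontrivial, hence the properness condition. *)
Record relators (A : nzRingType) := Relators {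
  relator :> A -> Prop;
  relators_proper : 1 \notin genideal relator }.

Section Presented.
Variables (K : comNzRingType) (A : algType K) (rel : relators A).

Lemma genidealZ (c : K) a : a \in genideal rel -> c *: a \in genideal rel.
Proof. by move=> Ia; rewrite -[a]mul1r scalerAl genidealMl. Qed.

(* The quotient of A by the two-sided ideal generated by the relators. *)
Definition presented := Quotient.quot (genideal rel).
HB.instance Definition _ := Choice.on presented.
HB.instance Definition _ := GRing.Zmodule.on presented.

Definition pres_pi (a : A) : presented := \pi_(Quotient.quot (genideal rel)) a.
Definition pres_repr (x : presented) : A := repr x.

Lemma pres_reprK x : pres_pi (pres_repr x) = x.
Proof. exact: reprK. Qed.

Lemma pres_pi_eq a b : (pres_pi a = pres_pi b) <-> (a - b \in genideal rel).
Proof.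
rewrite Quotient.idealrBE; split; first by move=> h; apply/eqP.
by move/eqP.
Qed.

Definition pres_one : presented := pres_pi 1.
Definition pres_mul (x y : presented) : presented :=
  pres_pi (pres_repr x * pres_repr y).
Definition pres_scale (c : K) (x : presented) : presented :=
  pres_pi (c *: pres_repr x).

Let piD a b : pres_pi (a + b) = pres_pi a + pres_pi b.
Proof. exact: pi_addr. Qed.

Let pi0 : pres_pi 0 = 0.
Proof. by apply: (addrI (pres_pi 0)); rewrite -piD !addr0. Qed.

Let piM a b : pres_mul (pres_pi a) (pres_pi b) = pres_pi (a * b).
Proof.
apply/pres_pi_eq.
have E (a' b' : A) : a' * b' - a * b = (a' - a) * b' + a * (b' - b).
  by rewrite mulrBl mulrBr addrA subrK.
rewrite E; apply: rpredD; [apply: genidealMr|apply: genidealMl];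
  by apply/pres_pi_eq; rewrite pres_reprK.
Qed.

Let piZ c a : pres_scale c (pres_pi a) = pres_pi (c *: a).
Proof.
by apply/pres_pi_eq; rewrite -scalerBr; apply/genidealZ/pres_pi_eq/pres_reprK.
Qed.

Fact pres_mulA : associative pres_mul.
Proof.
move=> x y z; rewrite -[x]pres_reprK -[y]pres_reprK -[z]pres_reprK.
by rewrite !piM mulrA.
Qed.

Fact pres_mul1 : left_id pres_one pres_mul.
Proof. by move=> x; rewrite -[x]pres_reprK piM mul1r. Qed.

Fact pres_mulr1 : right_id pres_one pres_mul.
Proof. by move=> x; rewrite -[x]pres_reprK piM mulr1. Qed.

Fact pres_mulDl : left_distributive pres_mul +%R.
Proof.
move=> x y z; rewrite -[x]pres_reprK -[y]pres_reprK -[z]pres_reprK.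
by rewrite -piD !piM mulrDl piD.
Qed.

Fact pres_mulDr : right_distributive pres_mul +%R.
Proof.
move=> x y z; rewrite -[x]pres_reprK -[y]pres_reprK -[z]pres_reprK.
by rewrite -piD !piM mulrDr piD.
Qed.

Fact pres_one_neq0 : pres_one != 0.
Proof.
apply/negP => /eqP; rewrite -pi0 => /pres_pi_eq; rewrite subr0.
exact/negP/relators_proper.
Qed.

HB.instance Definition _ := GRing.Zmodule_isNzRing.Build presented
  pres_mulA pres_mul1 pres_mulr1 pres_mulDl pres_mulDr pres_one_neq0.

Fact pres_scaleA a b x : pres_scale a (pres_scale b x) = pres_scale (a * b) x.
Proof. by rewrite -[x]pres_reprK !piZ scalerA. Qed.

Fact pres_scale1 : left_id 1 pres_scale.
Proof. by move=> x; rewrite -[x]pres_reprK piZ scale1r. Qed.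

Fact pres_scaleDr : right_distributive pres_scale +%R.
Proof.
move=> c x y; rewrite -[x]pres_reprK -[y]pres_reprK.
by rewrite -piD !piZ scalerDr piD.
Qed.

Fact pres_scaleDl x : {morph pres_scale^~ x : a b / a + b}.
Proof. by move=> a b; rewrite -[x]pres_reprK !piZ scalerDl piD. Qed.

HB.instance Definition _ := GRing.Zmodule_isLmodule.Build K presented
  pres_scaleA pres_scale1 pres_scaleDr pres_scaleDl.

Fact pres_pi_zmod_morphism : zmod_morphism pres_pi.
Proof. exact: pi_is_zmod_morphism. Qed.
HB.instance Definition _ := GRing.isZmodMorphism.Build A presented pres_pi
  pres_pi_zmod_morphism.

Fact pres_pi_monoid_morphism : monoid_morphism pres_pi.
Proof. by split=> // a b; rewrite -piM. Qed.
HB.instance Definition _ := GRing.isMonoidMorphism.Build A presented pres_pi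
  pres_pi_monoid_morphism.

Fact pres_pi_scalable : scalable pres_pi.
Proof. by move=> c a; rewrite -piZ. Qed.
HB.instance Definition _ := GRing.isScalable.Build K A presented *:%R pres_pi
  pres_pi_scalable.

Fact pres_scaleAl (c : K) (x y : presented) : c *: (x * y) = c *: x * y.
Proof.
rewrite -[x]pres_reprK -[y]pres_reprK.
by rewrite -rmorphM -!linearZ -rmorphM /= scalerAl.
Qed.

HB.instance Definition _ :=
  GRing.Lmodule_isLalgebra.Build K presented pres_scaleAl.

Fact pres_scaleAr (c : K) (x y : presented) : c *: (x * y) = x * (c *: y).
Proof.
rewrite -[x]pres_reprK -[y]pres_reprK.
by rewrite -rmorphM -!linearZ -rmorphM /= scalerAr.
Qed.

HB.instance Definition _ :=
  GRing.Lalgebra_isAlgebra.Build K presented pres_scaleAr.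

Definition pres_unit : {pred presented} :=
  fun x => `[< exists y, y * x = 1 /\ x * y = 1 >].

Definition pres_inv (x : presented) : presented :=
  if pselect (exists y, y * x = 1 /\ x * y = 1) is left xU
  then projT1 (cid xU) else x.

Fact pres_mulVr : {in pres_unit, left_inverse 1 pres_inv *%R}.
Proof.
move=> x /asboolP xU; rewrite /pres_inv; case: pselect => // e.
by case: (cid e) => y [].
Qed.

Fact pres_mulrV : {in pres_unit, right_inverse 1 pres_inv *%R}.
Proof.
move=> x /asboolP xU; rewrite /pres_inv; case: pselect => // e.
by case: (cid e) => y [].
Qed.

Fact pres_unitP (x y : presented) : y * x = 1 /\ x * y = 1 -> x \in pres_unit.
Proof. by move=> xy; apply/asboolP; exists y. Qed.

Fact pres_inv_out : {in [predC pres_unit], pres_inv =1 id}.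
Proof.
move=> x /negP xU; rewrite /pres_inv; case: pselect => // e.
by case: xU; apply/asboolP.
Qed.

HB.instance Definition _ := GRing.NzRing_hasMulInverse.Build presented
  pres_mulVr pres_mulrV pres_unitP pres_inv_out.

Lemma pres_relP a b : rel (a - b) -> pres_pi a = pres_pi b.
Proof. by move=> r; apply/pres_pi_eq/genideal_rel. Qed.

End Presented.

Lemma malg_scaleAr (K : comNzRingType) (M : monomType) (c : K)
  (a b : {malg K[M]}) : c *: (a * b) = a * (c *: b).
Proof.
rewrite (malgMEw (fsubset_refl (msupp a)) (fsubset_refl (msupp b))).
rewrite (malgMEw (fsubset_refl (msupp a)) (msuppZ_le c b)).
rewrite scaler_sumr; apply: eq_bigr => i _.
rewrite scaler_sumr; apply: eq_bigr => j _.
rewrite mcoeffZ mulrCA; apply/malgP => k.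
by rewrite mcoeffZ !mcoeffU mulrnAr.
Qed.

Section FreeAlgebra.
Variables (K : comNzRingType) (X : choiceType).

(* The free unital associative K-algebra on X: the algebra of the free monoid
   on X. *)
Definition freealg := {malg K[{fmonom X}]}.
HB.instance Definition _ := GRing.Lalgebra.on freealg.

HB.instance Definition _ :=
  GRing.Lalgebra_isAlgebra.Build K freealg (@malg_scaleAr K {fmonom X}).

Definition freealg_gen (x : X) : freealg := << fmu x >>.

Let one_monom (m : {fmonom X}) : K := 1.

Let one_monom_mmorphism : mmorphism one_monom.
Proof. by split=> [x y|] //; rewrite /one_monom mulr1. Qed.

HB.instance Definition _ :=
  isMultiplicative.Build {fmonom X} K one_monom one_monom_mmorphism.

(* The augmentation, sending every generator to 1; all Yokonuma-Hecke relators
   lie in its kernel, whence their properness. *)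
Definition freealg_aug (a : freealg) : K := mmap idfun one_monom a.

HB.instance Definition _ :=
  GRing.LRMorphism.copy freealg_aug (mmap idfun one_monom).

Lemma freealg_aug_gen x : freealg_aug (freealg_gen x) = 1.
Proof. by rewrite /freealg_aug mmapU mulr1. Qed.

End FreeAlgebra.

Lemma aug_proper (K : comNzRingType) (X : choiceType)
    (rel : freealg K X -> Prop) :
  (forall a, rel a -> freealg_aug a = 0) -> 1 \notin genideal rel.
Proof.
move=> aug0; apply/negP => /genidealP[s Hs E].
have: freealg_aug (1 : freealg K X) = 0.
  rewrite E rmorph_sum big_seq big1 // => p /Hs /aug0 Hp.
  by rewrite !rmorphM /= Hp mulr0 mul0r.
by rewrite rmorph1; apply/eqP; rewrite oner_eq0.
Qed.

Section Indices.
Variable n : nat.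

Fact node_lo_subproof (i : 'I_n.-1) : (i < n)%N.
Proof. exact: leq_trans (ltn_ord i) (leq_pred n). Qed.

Fact node_hi_subproof (i : 'I_n.-1) : (i.+1 < n)%N.
Proof. by rewrite -ltn_predRL. Qed.

(* Indices are 0-based: i : 'I_n.-1 stands for the index i+1 of g_1, ..., g_{n-1},
   and node_lo i, node_hi i for the indices i+1, i+2 of t_1, ..., t_n. *)
Definition node_lo (i : 'I_n.-1) : 'I_n := Ordinal (node_lo_subproof i).
Definition node_hi (i : 'I_n.-1) : 'I_n := Ordinal (node_hi_subproof i).

Definition simple_refl (i : 'I_n.-1) : {perm 'I_n} :=
  tperm (node_lo i) (node_hi i).

End Indices.

Section YHRelators.
Variables (K : fieldType) (d n : nat) (u : K) (A : algType K).
Variables (g : 'I_n.-1 -> A) (t : 'I_n -> A).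

(* A free algebra has no inverse of t_j, so t_j^{-m} is written t_j^{d-m};
   YH_relations gives the form with inverses in the quotient. *)
Definition idem_e (i : 'I_n.-1) : A :=
  (d%:R : K)^-1 *:
    \sum_(m < d) t (node_lo i) ^+ m * t (node_hi i) ^+ (d - m).

Inductive YHrel : A -> Prop :=
| YHrel_far (i j : 'I_n.-1) of (1 < `|i - j|)%N :
    YHrel (g i * g j - g j * g i)
| YHrel_braid (i j : 'I_n.-1) of `|i - j|%N = 1%N :
    YHrel (g i * g j * g i - g j * g i * g j)
| YHrel_tt (i j : 'I_n) :
    YHrel (t i * t j - t j * t i)
| YHrel_tg (i : 'I_n.-1) (j : 'I_n) :
    YHrel (t j * g i - g i * t (simple_refl i j))
| YHrel_td (j : 'I_n) :
    YHrel (t j ^+ d - 1)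
| YHrel_gg (i : 'I_n.-1) :
    YHrel (g i ^+ 2 -
      (1 + (u - 1) *: idem_e i - (u - 1) *: (idem_e i * g i))).

Lemma YHrel_kernel (f : {lrmorphism A -> K^o}) a :
  (forall i, f (g i) = 1) -> (forall j, f (t j) = 1) -> YHrel a -> f a = 0.
Proof.
move=> g1 t1; case=> [i j _|i j _|i j|i j|j|i].
- by rewrite rmorphB !rmorphM /= !g1 subrr.
- by rewrite rmorphB !rmorphM /= !g1 subrr.
- by rewrite rmorphB !rmorphM /= !t1 subrr.
- by rewrite rmorphB !rmorphM /= g1 !t1 subrr.
- by rewrite rmorphB rmorphXn rmorph1 /= t1 expr1n subrr.
have fZ c x : f (c *: x) = c * f x by exact: linearZ.
move: (idem_e i) => e; rewrite !rmorphB rmorphD rmorphXn rmorph1 /= !fZ.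
by rewrite rmorphM /= !g1 expr1n mulr1 addrK subrr.
Qed.

Lemma YHrel_image (B : unitAlgType K) (f : {lrmorphism A -> B}) :
  (forall a, YHrel a -> f a = 0) ->
  [/\ forall i j : 'I_n.-1, (1 < `|i - j|)%N ->
        f (g i) * f (g j) = f (g j) * f (g i),
      forall i j : 'I_n.-1, `|i - j|%N = 1%N ->
        f (g i) * f (g j) * f (g i) = f (g j) * f (g i) * f (g j),
      forall i j, f (t i) * f (t j) = f (t j) * f (t i),
      forall i j, f (t j) * f (g i) = f (g i) * f (t (simple_refl i j))
    & forall j, f (t j) ^+ d = 1] /\
  (forall i, (0 < d)%N -> let e := (d%:R : K)^-1 *:
      \sum_(m < d) f (t (node_lo i)) ^+ m * f (t (node_hi i)) ^- m in
     f (g i) ^+ 2 = 1 + (u - 1) *: e - (u - 1) *: (e * f (g i))).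
Proof.
move=> f0; have fE a b : YHrel (a - b) -> f a = f b.
  by move=> /f0; rewrite rmorphB => /eqP; rewrite subr_eq0 => /eqP.
have fX j : f (t j) ^+ d = 1.
  by rewrite -rmorphXn -(rmorph1 f); apply: fE; apply: YHrel_td.
split; first split=> //.
- by move=> i j ij; rewrite -!rmorphM; apply: fE; apply: YHrel_far.
- by move=> i j ij; rewrite -!rmorphM; apply: fE; apply: YHrel_braid.
- by move=> i j; rewrite -!rmorphM; apply: fE; apply: YHrel_tt.
- by move=> i j; rewrite -!rmorphM; apply: fE; apply: YHrel_tg.
move=> i d_gt0 e; have fZ c x : f (c *: x) = c *: f x by exact: linearZ.
have <- : f (idem_e i) = e.
  rewrite fZ rmorph_sum; congr (_ *: _); apply: eq_bigr => m _ /=.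
  rewrite rmorphM !rmorphXn; congr (_ * _) => /=.
  have tU : f (t (node_hi i)) \is a GRing.unit.
    apply/unitrP; exists (f (t (node_hi i)) ^+ d.-1).
    by rewrite -exprSr -exprS prednK.
  apply: (mulIr (unitrX m tU)); rewrite mulVr ?unitrX // -exprD subnK //.
  exact/ltnW.
have -> : f (g i) ^+ 2 = f (g i ^+ 2) by rewrite rmorphXn.
rewrite (fE _ _ (YHrel_gg i)); move: (idem_e i) => x.
by rewrite rmorphB rmorphD rmorph1 /= !fZ rmorphM.
Qed.

End YHRelators.

Section YokonumaHecke.
Variables (K : fieldType) (d n : nat) (u : K).

Definition YHletter := ('I_n.-1 + 'I_n)%type.

Definition free_g (i : 'I_n.-1) : freealg K YHletter := freealg_gen K (inl i).
Definition free_t (j : 'I_n) : freealg K YHletter := freealg_gen K (inr j).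

Fact YHrel_proper : 1 \notin genideal (YHrel d u free_g free_t).
Proof.
apply: aug_proper => a.
by apply: YHrel_kernel => [i|j]; exact: freealg_aug_gen.
Qed.

Definition YHrelators := Relators YHrel_proper.

(* The Yokonuma-Hecke algebra Y_{d,n}(u) over K. *)
Definition YH := presented YHrelators.
HB.instance Definition _ := GRing.UnitAlgebra.on YH.

Definition YH_g (i : 'I_n.-1) : YH := pres_pi YHrelators (free_g i).
Definition YH_t (j : 'I_n) : YH := pres_pi YHrelators (free_t j).
Definition YH_e (i : 'I_n.-1) : YH :=
  (d%:R : K)^-1 *: \sum_(m < d) YH_t (node_lo i) ^+ m * YH_t (node_hi i) ^- m.

Let piP a : YHrel d u free_g free_t a -> pres_pi YHrelators a = 0.
Proof.
move=> ra; rewrite -(raddf0 (pres_pi YHrelators)).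
by apply: pres_relP; rewrite subr0.
Qed.

Lemma YH_relations :
  [/\ forall i j : 'I_n.-1, (1 < `|i - j|)%N ->
        YH_g i * YH_g j = YH_g j * YH_g i,
      forall i j : 'I_n.-1, `|i - j|%N = 1%N ->
        YH_g i * YH_g j * YH_g i = YH_g j * YH_g i * YH_g j,
      forall i j, YH_t i * YH_t j = YH_t j * YH_t i,
      forall i j, YH_t j * YH_g i = YH_g i * YH_t (simple_refl i j)
    & forall j, YH_t j ^+ d = 1] /\
  (forall i, (0 < d)%N -> YH_g i ^+ 2 =
     1 + (u - 1) *: YH_e i - (u - 1) *: (YH_e i * YH_g i)).
Proof. exact: (YHrel_image piP). Qed.

End YokonumaHecke.

Arguments YH_g {K} d n u i.
Arguments YH_t {K} d n u j.
Arguments YH_e {K} d n u i.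

(* Main.v *)
(* The average [e] of the powers of [t_i t_{i+1}^-1], an element whose d-th power
   is 1, is idempotent. Multiplying the quadratic relation by [e] on the left
   gives [e g^2 = u e - (u - 1) e g]; substituting this in [g^2 g] yields
   [g^3 = g + u (u - 1) e g - u (u - 1) e], and the quadratic relation turns the
   last two terms into [- u (g^2 - 1)]. *)
Require Import Defs.
From mathcomp Require Import all_boot all_order all_algebra.
From mathcomp Require Import reals complex.

Set Implicit Arguments.
Unset Strict Implicit.
Unset Printing Implicit Defensive.

Import GRing.Theory Num.Theory.
Local Open Scope ring_scope.

(** The difference of the two sides is the geometric sum times [x - 1], which telescopes to
    [x ^+ d - 1]. *)
Lemma mulr_sum_expr (A : pzRingType) (d : nat) (x : A) :
  x ^+ d = 1 -> x * (\sum_(m < d) x ^+ m) = \sum_(m < d) x ^+ m.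
Proof.
move=> xd; apply/eqP; rewrite -subr_eq0 -[X in _ - X]mul1r -mulrBl.
by rewrite -subrX1 xd subrr.
Qed.

Lemma average_expr_idem (K : fieldType) (A : algType K) (d : nat) (x : A) :
  d%:R != 0 :> K -> x ^+ d = 1 ->
  let e := d%:R^-1 *: \sum_(m < d) x ^+ m in e * e = e.
Proof.
move=> d_neq0 xd e; set s := \sum_(m < d) x ^+ m in e *.
have xs m : x ^+ m * s = s.
  by elim: m => [|m IHm]; rewrite ?mul1r // exprSr -mulrA mulr_sum_expr.
(* Each of the [d] summands of the left factor fixes [s]. *)
have ss : s * s = d%:R *: s.
  rewrite {1}/s mulr_suml; under eq_bigr => m _ do rewrite xs.
  by rewrite sumr_const card_ord scaler_nat.
by rewrite /e -scalerAl -scalerAr ss [_^-1 *: (d%:R *: _)]scalerA mulVf //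
  scale1r.
Qed.

Lemma cubic_of_quadratic (K : fieldType) (A : algType K) (u : K) (e g : A) :
  e * e = e -> g ^+ 2 = 1 + (u - 1) *: e - (u - 1) *: (e * g) ->
  g ^+ 3 = - u *: g ^+ 2 + g + u%:A.
Proof.
move=> ee gg.
have uE (x : A) : x + (u - 1) *: x = u *: x.
  by rewrite -{1}[x]scale1r -scalerDl addrC subrK.
have egg : e * g ^+ 2 = u *: e - (u - 1) *: (e * g).
  by rewrite gg mulrBr mulrDr mulr1 -!scalerAr mulrA ee uE.
have -> : g ^+ 3 = g + (u - 1) *: (u *: (e * g)) - (u - 1) *: (u *: e).
  rewrite exprSr {1}gg mulrBl mulrDl mul1r -!scalerAl -mulrA -expr2 egg.
  (* The coefficient of [e * g] is [(u - 1) + (u - 1)^2 = (u - 1) u]. *)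
  by rewrite -[u *: (e * g)]uE scalerBr scalerDr opprB !addrA.
rewrite gg scalerBr scalerDr !scaleNr opprK !scalerA ![u * (u - 1)]mulrC.
rewrite [RHS]addrC !addrA subrr add0r [RHS]addrC -addrA; congr (_ + _).
by rewrite addrC.
Qed.

(** The cubic relation reads [g (g^2 + u g - 1) = u]; dividing by [u] gives the inverse. *)
Lemma inv_of_cubic (K : fieldType) (A : unitAlgType K) (u : K) (g : A) :
  u != 0 -> g ^+ 3 = - u *: g ^+ 2 + g + u%:A ->
  g \is a GRing.unit /\ g^-1 = u^-1 *: g ^+ 2 + g - u^-1%:A.
Proof.
move=> u_neq0 ggg; set h := _ - _.
have gh : g * h = 1.
  rewrite /h mulrBr mulrDr -!scalerAr mulr1 -exprS -expr2 ggg.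
  rewrite scaleNr !scalerDr scalerN !scalerA mulVf // !scale1r.
  rewrite [X in X - _]addrC !addrA subrr add0r.
  by rewrite addrAC subrr add0r.
(* As a polynomial in [g], [h] commutes with [g], so it is a two-sided inverse. *)
have hg : h * g = 1.
  rewrite -gh /h mulrBl mulrBr mulrDl mulrDr -!scalerAl -!scalerAr.
  by rewrite mul1r mulr1 -exprSr -exprS.
have gU : g \is a GRing.unit by apply/unitrP; exists h.
by split=> //; rewrite -[LHS]mulr1 -gh mulKr.
Qed.

(** Since [x] and [y] commute, the summands are the powers of [x / y], whose [d]-th power is 1. *)
Lemma average_div_expr_idem (K : fieldType) (A : unitAlgType K) (d : nat)
    (x y : A) :
  d%:R != 0 :> K -> GRing.comm x y -> x ^+ d = 1 -> y ^+ d = 1 ->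
  let e := d%:R^-1 *: \sum_(m < d) x ^+ m * y ^- m in e * e = e.
Proof.
move=> d_neq0 xy xd yd e; have xyV : GRing.comm x y^-1 by apply: commrV.
have -> : e = d%:R^-1 *: \sum_(m < d) (x / y) ^+ m.
  by congr (_ *: _); apply: eq_bigr => m _; rewrite exprMn_comm // exprVn.
by apply: average_expr_idem; rewrite // exprMn_comm // exprVn xd yd invr1 mulr1.
Qed.

Theorem lemma5 (R : realType) (d n : nat) (u : R[i])
    (d_ge1 : (1 <= d)%N) (n_ge1 : (1 <= n)%N) (u_neq0 : u != 0) (u_neq1 : u != 1)
    (i : 'I_n.-1) :
  let g : YH d n u := YH_g d n u i in
  g ^+ 3 = - u *: g ^+ 2 + g + u%:A /\
  (g \is a GRing.unit /\ g^-1 = u^-1 *: g ^+ 2 + g - u^-1%:A).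
Proof.
move=> g; have [[_ _ tt _ td] /(_ i d_ge1) gg] := YH_relations d n u.
(* [R[i]] has characteristic 0, so averaging over [d] terms is legitimate. *)
have d_neq0 : d%:R != 0 :> R[i] by rewrite pnatr_eq0 -lt0n.
have ee : YH_e d n u i * YH_e d n u i = YH_e d n u i.
  exact: average_div_expr_idem d_neq0 (tt _ _) (td _) (td _).
have ggg := cubic_of_quadratic ee gg.
by split; [exact: ggg | exact: inv_of_cubic u_neq0 ggg].
Qed.
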